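(* Let $\mu$ be either a C-convex lower prevision or a C-convex upper prevision defined on a set $\mathcal{S}$ of conditional gambles with $\mathcal{S}\supseteq\{X|B,\,Y|D\}$. Then $$X|B\leq_{GN}Y|D\ \Longrightarrow\ \mu(X|B)\leq\mu(Y|D).$$
   Context: Events are subsets of a nonempty set $\Omega$ (the sure event); $\wedge,\vee,\neg$ denote intersection, union, complement; an event $B$ is identified with its indicator $I_B$. A gamble is a bounded function $X:\Omega\to\mathbb{R}$. For an event $B\neq\varnothing$, the conditional gamble $X|B$ is the restriction of $X$ to $B$ (so two conditional gambles with the same $B$ and the same restriction are identified); $\sup(X|B)=\sup_BX=\sup_{\omega\in B}X(\omega)$ and $\inf_B X=\inf_{\omega\in B}X(\omega)$. A map $\underline P:\mathcal{S}\to\mathbb{R}$ (lower prevision) is convex iff for all $n\in\mathbb{N}$, all $X_0|B_0,\dots,X_n|B_n\in\mathcal{S}$ and all real $s_0,\dots,s_n\ge 0$ with $\sum_{i=1}^n s_i=s_0>0$, setting $B=\bigvee_{i=0}^n B_i$ and $\underline G=\sum_{i=1}^n s_iB_i(X_i-\underline P(X_i|B_i))-s_0B_0(X_0-\underline P(X_0|B_0))$, one has $\sup(\underline G|B)\ge 0$. It is C-convex (centered convex) iff it is convex and $X|B\in\mathcal{S}$ implies $0|B\in\mathcal{S}$ and $\underline P(0|B)=0$. A map $\overline P:\mathcal{S}\to\mathbb{R}$ (upper prevision) is C-convex iff the lower prevision $-X|B\mapsto-\overline P(X|B)$ on $\{-X|B: X|B\in\mathcal{S}\}$ is C-convex. Generalised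 Goodman-Nguyen relation for conditional gambles: $X|B\leq_{GN}Y|D$ iff for every $\omega\in\Omega$ $$I_B(\omega)X(\omega)+I_{\neg B\wedge D}(\omega)\sup_BX\ \leq\ I_D(\omega)Y(\omega)+I_{B\wedge\neg D}(\omega)\inf_DY .$$ *)

(* Defs.v *)
From mathcomp Require Import all_boot all_order all_algebra.
From mathcomp Require Import all_classical all_reals all_analysis.

Set Implicit Arguments.
Unset Strict Implicit.
Unset Printing Implicit Defensive.

Import Order.TTheory GRing.Theory Num.Theory.
Import numFieldNormedType.Exports.

Local Open Scope classical_set_scope.
Local Open Scope ring_scope.

Record gamble (R : realType) (Omega : Type) := Gamble {
  gamble_fun :> Omega -> R;
  gamble_bounded : bounded_fun (gamble_fun : Omega -> R^o) }.

Record nonempty_event (Omega : Type) := NonemptyEvent {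
  event_set :> set Omega;
  event_neq0 : event_set !=set0 }.

(* A real function whose domain is the subtype of the conditioning event:
   Leibniz equality of conditional gambles is then equality of the events and
   of the restrictions. *)
Record cgamble (R : realType) (Omega : Type) := CGamble {
  cg_event : nonempty_event Omega;
  cg_fun : cg_event -> R;
  cg_bounded : bounded_fun (cg_fun : cg_event -> R^o) }.

Section ConditionalGambles.
Context (R : realType) (Omega : Type).
Implicit Types (X Y : gamble R Omega) (B D : nonempty_event Omega).

Fact sigL_bounded X B : bounded_fun (sigL B X : B -> R^o).
Proof.
case: X => f [M [Mr hM]]; exists M; split=> // x Mx b _ /=.
exact: (hM x Mx (set_val b)).
Qed.

Definition restrictg X B : cgamble R Omega := CGamble (sigL_bounded X B).

Lemma restrictg_eq X Y B :
  restrictg X B = restrictg Y B <-> {in event_set B, X =1 Y}.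
Proof.
split=> [e | /eq_sigLP h].
  apply/eq_sigLP; apply: (can_inj (valLK (0 : R))).
  exact: (congr1 (fun c => valL_ (0 : R) (@cg_fun _ _ c)) e).
rewrite /restrictg; move: (sigL_bounded X B) (sigL_bounded Y B).
by rewrite h => p q; rewrite (Prop_irrelevance p q).
Qed.

Definition zerog : gamble R Omega := Gamble (bounded_cst (0 : R^o) setT).

Definition oppcg (c : cgamble R Omega) : cgamble R Omega :=
  CGamble (bounded_funN (@cg_bounded _ _ c)).

End ConditionalGambles.

Notation "X '|_(' B )" := (restrictg X B) (at level 10, format "X '|_(' B )").

Section Previsions.
Context (R : realType) (Omega : Type).
Implicit Types (S : set (cgamble R Omega)) (P : cgamble R Omega -> R).

(* A prevision on S is given by a total function P of which only the values
   on S matter. *)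

Definition gain P n (X : 'I_n.+1 -> gamble R Omega)
    (B : 'I_n.+1 -> nonempty_event Omega) (s : 'I_n.+1 -> R) (w : Omega) : R :=
  \sum_(i < n.+1 | i != ord0) s i * \1_(B i) w * (X i w - P (X i |_(B i)))
  - s ord0 * \1_(B ord0) w * (X ord0 w - P (X ord0 |_(B ord0))).

Definition convex_lower S P : Prop :=
  forall n (X : 'I_n.+1 -> gamble R Omega)
      (B : 'I_n.+1 -> nonempty_event Omega) (s : 'I_n.+1 -> R),
    (forall i, S (X i |_(B i))) ->
    (forall i, 0 <= s i) ->
    \sum_(i < n.+1 | i != ord0) s i = s ord0 ->
    0 < s ord0 ->
    0 <= sup (gain P X B s @` \bigcup_(i in [set: 'I_n.+1]) B i).

Definition c_convex_lower S P : Prop :=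
  convex_lower S P /\
  forall X B, S (X |_(B)) ->
    S (zerog R Omega |_(B)) /\ P (zerog R Omega |_(B)) = 0.

Definition c_convex_upper S P : Prop :=
  c_convex_lower (@oppcg R Omega @` S) (fun c => - P (oppcg c)).

Definition gn_le (X : gamble R Omega) (B : nonempty_event Omega)
    (Y : gamble R Omega) (D : nonempty_event Omega) : Prop :=
  forall w : Omega,
    \1_B w * X w + \1_(~` B `&` D) w * sup (X @` B)
    <= \1_D w * Y w + \1_(B `&` ~` D) w * inf (Y @` D).

End Previsions.

(* Main.v *)
(** By centering, [P(X|B)] lies between [inf_B X] and [sup_B X]. Take weights 1
    and compare the gain of buying [X|B] and selling [Y|D] with
    [P(Y|D) - P(X|B)]: it is at most that constant on [B /\ D] because [X <= Y]
    there, on [B /\ ~D] because [X <= inf_D Y <= P(Y|D)], and on [D /\ ~B]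
    because [Y >= sup_B X >= P(X|B)]. Convexity makes the constant nonnegative.
    Upper previsions follow by conjugacy, since [X|B <=_GN Y|D] gives
    [-Y|D <=_GN -X|B]. *)
Require Import Defs.
From mathcomp Require Import all_boot all_order all_algebra.
From mathcomp Require Import all_classical all_reals all_analysis.
From mathcomp Require Import lra.

Import Order.TTheory GRing.Theory Num.Theory.

Local Open Scope classical_set_scope.
Local Open Scope ring_scope.

Section GambleBounds.
Context (R : realType) (Omega : Type).
Implicit Types (X : gamble R Omega) (B : nonempty_event Omega).

Lemma gamble_abs_bounded X : exists M : R, forall w, `|X w| <= M.
Proof.
(* [bounded_fun] provides the bound only for reals strictly above [M], hence [M + 1]. *)
have [M [_ hM]] := gamble_bounded X; exists (M + 1) => w.
by apply: (hM (M + 1)) => //; rewrite ltrDl.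
Qed.

Lemma gamble_has_sup X B : has_sup (X @` B).
Proof.
split; first by have [w Bw] := event_neq0 B; exists (X w), w.
have [M hM] := gamble_abs_bounded X; exists M => _ [w _ <-].
exact: le_trans (ler_norm _) (hM w).
Qed.

Lemma gamble_has_inf X B : has_inf (X @` B).
Proof.
split; first by have [w Bw] := event_neq0 B; exists (X w), w.
have [M hM] := gamble_abs_bounded X; exists (- M) => _ [w _ <-].
by have := hM w; rewrite ler_norml => /andP[].
Qed.

Lemma gamble_le_sup X B w : event_set B w -> X w <= sup (X @` B).
Proof. by move=> Bw; apply: ub_le_sup; [case: (gamble_has_sup X B) | exists w]. Qed.

Lemma gamble_ge_inf X B w : event_set B w -> inf (X @` B) <= X w.
Proof. by move=> Bw; apply: ge_inf; [case: (gamble_has_inf X B) | exists w]. Qed.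

End GambleBounds.

Section LowerPrevisions.
Context {R : realType} {Omega : Type}.
Context {S : set (cgamble R Omega)} {P : cgamble R Omega -> R}.
Implicit Types (X Y : gamble R Omega) (B D : nonempty_event Omega).

(** Convexity with two conditional gambles and unit weights: [c] bounds the gain on the union of the
    events, hence also its supremum, which is nonnegative. *)
Lemma convex_lower_pair_gain X Y B D (c : R) :
  convex_lower S P -> S (X |_(B)) -> S (Y |_(D)) ->
  (forall w, (B `|` D) w ->
     \1_B w * (X w - P (X |_(B))) - \1_D w * (Y w - P (Y |_(D))) <= c) ->
  0 <= c.
Proof.
move=> cvx SX SY hc.
(* Index 0 carries the subtracted term of [gain], so it receives [Y] and [D]. *)
pose Z (i : 'I_2) := if i == ord0 then Y else X.
pose E (i : 'I_2) := if i == ord0 then D else B.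
have hS i : S (Z i |_(E i)) by rewrite /Z /E; case: ifP.
apply: (le_trans (cvx 1%N Z E (fun=> 1) hS _ _ _)) => //.
  by rewrite big_mkcond !big_ord_recl big_ord0 /= add0r addr0.
apply: ge_sup.
  have [w Dw] := event_neq0 D.
  by exists (gain P Z E (fun=> 1) w), w => //; exists ord0.
move=> _ [w [i _ Ew] <-].
rewrite /gain big_mkcond !big_ord_recl big_ord0 /= add0r addr0 !mul1r.
by apply: hc; move: Ew; rewrite /E; case: ifP => _; [right | left].
Qed.

(** Pairing with the zero gamble on the same event leaves the gain [X - P (X |_(B))] on [B]. *)
Lemma c_convex_lower_le_sup X B :
  c_convex_lower S P -> S (X |_(B)) -> P (X |_(B)) <= sup (X @` B).
Proof.
move=> [cvx cent] SX; have [S0 P0] := cent _ _ SX.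
rewrite -subr_ge0; apply: (convex_lower_pair_gain X (zerog R Omega) B B _ cvx) => // w.
rewrite setUid => Bw; rewrite P0 /= subrr mulr0 subr0 indicE mem_set// mul1r.
by rewrite lerD2r gamble_le_sup.
Qed.

Lemma c_convex_lower_ge_inf X B :
  c_convex_lower S P -> S (X |_(B)) -> inf (X @` B) <= P (X |_(B)).
Proof.
move=> [cvx cent] SX; have [S0 P0] := cent _ _ SX.
rewrite -subr_ge0; apply: (convex_lower_pair_gain (zerog R Omega) X B B _ cvx) => // w.
rewrite setUid => Bw; rewrite P0 /= subrr mulr0 sub0r indicE mem_set// mul1r.
by rewrite opprB lerD2l lerN2 gamble_ge_inf.
Qed.

Lemma c_convex_lower_gn_le X Y B D :
  c_convex_lower S P -> S (X |_(B)) -> S (Y |_(D)) ->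
  gn_le X B Y D -> P (X |_(B)) <= P (Y |_(D)).
Proof.
move=> cP SX SY gn; rewrite -subr_ge0.
apply: (convex_lower_pair_gain X Y B D _ (proj1 cP)) => //.
have Psup := c_convex_lower_le_sup X B cP SX; have Pinf := c_convex_lower_ge_inf Y D cP SY.
move=> w BDw; have := gn w; rewrite !indicE !in_setI !in_setC.
(* Outside both events the gain is 0, which need not lie below the constant; this case must be
   excluded. The other three are linear. *)
have : (w \in event_set B) || (w \in event_set D).
  by case: BDw => h; rewrite (mem_set h) ?orbT.
case: (w \in event_set B); case: (w \in event_set D) => //= _; lra.
Qed.

End LowerPrevisions.

Section Conjugacy.
Context (R : realType) (Omega : Type).
Implicit Types (X Y : gamble R Omega) (B D : nonempty_event Omega).

Definition oppg X : gamble R Omega := Gamble (bounded_funN (gamble_bounded X)).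

Lemma eq_CGamble B (f g : B -> R)
    (fb : bounded_fun (f : B -> R^o)) (gb : bounded_fun (g : B -> R^o)) :
  f =1 g -> CGamble fb = CGamble gb.
Proof. by move=> /funext fg; subst g; rewrite (Prop_irrelevance fb gb). Qed.

Lemma oppcg_restrictg X B : oppcg (X |_(B)) = oppg X |_(B).
Proof. exact: eq_CGamble. Qed.

Lemma oppcgK : involutive (@oppcg R Omega).
Proof. by case=> B f fb; apply: eq_CGamble => w /=; exact: opprK. Qed.

Lemma image_oppg X B : oppg X @` B = -%R @` (X @` B).
Proof. by rewrite image_comp. Qed.

(** Negation turns [sup] into [-inf] and conversely, so the pointwise inequality is negated and its
    sides trade places. *)
Lemma gn_le_opp X Y B D : gn_le X B Y D -> gn_le (oppg Y) D (oppg X) B.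
Proof.
move=> gn w; rewrite !image_oppg -[oppg Y w]/(- Y w) -[oppg X w]/(- X w).
have -> : sup (-%R @` (Y @` D)) = - inf (Y @` D) by rewrite /inf opprK.
have -> : inf (-%R @` (X @` B)) = - sup (X @` B).
  rewrite /inf; congr (- sup _); rewrite !image_comp.
  by apply: eq_imagel => x _ /=; exact: opprK.
by have := gn w; rewrite (setIC (~` D)) (setIC D); lra.
Qed.

End Conjugacy.

Theorem proposition10 (R : realType) (Omega : Type)
    (Omega_neq0 : [set: Omega] !=set0)
    (S : set (cgamble R Omega)) (mu : cgamble R Omega -> R)
    (X Y : gamble R Omega) (B D : nonempty_event Omega) :
  c_convex_lower S mu \/ c_convex_upper S mu ->
  S (X |_(B)) -> S (Y |_(D)) ->
  gn_le X B Y D -> mu (X |_(B)) <= mu (Y |_(D)).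
Proof.
move=> [cmu|cmu] SX SY gn; first exact: (c_convex_lower_gn_le X Y B D cmu).
have SN Z E : S (Z |_(E)) -> (@oppcg R Omega @` S) (oppg _ _ Z |_(E)).
  by move=> SZ; exists (Z |_(E)); rewrite ?oppcg_restrictg.
(* The conjugate at the opposite of [Z |_(E)] is [- mu (Z |_(E))] since [oppcg] is an involution;
   the two sign changes restore the order. *)
have := c_convex_lower_gn_le _ _ _ _ cmu (SN _ _ SY) (SN _ _ SX)
  (gn_le_opp _ _ _ _ _ _ gn).
by rewrite -!oppcg_restrictg !oppcgK lerN2.
Qed.
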